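(* Let $K\in\mathbb{R}$. Suppose $\triangle\tilde p\tilde q\tilde r$ is a triangle satisfying size bounds for $K$ in a model plane of curvature $K$. Let $\tilde m$ be a point on side $\tilde p\tilde r$, and let $\lambda\in[0,1]$ be its affine parameter on the side directed from $\tilde p$ to $\tilde r$. Let $\triangle q_1p_1m_1$ and $\triangle q_2m_2r_2$ be triangles in respective (possibly different) model planes of curvature $K$, where $|q_1m_1|=|q_2m_2|$, $|q_1p_1|=|\tilde q\tilde p|$, $|q_2r_2|=|\tilde q\tilde r|$, $|p_1m_1|=|\tilde p\tilde m|$, and $|m_2r_2|=|\tilde m\tilde r|$. Assume, for $i=1,2$, $|q_im_i|<\pi/\sqrt{K}$ if $K>0$, and $|q_im_i|>-\pi/\sqrt{-K}$ if $K<0$. If $$(1-\lambda)\,\angle p_1m_1q_1+\lambda\,\angle r_2m_2q_2\ge 0,$$ then $$\angle\tilde q\tilde p\tilde m\ge\angle q_1p_1m_1\quad\text{and}\quad\angle\tilde q\tilde r\tilde m\ge\angle q_2r_2m_2 .$$ The same statement holds with all (displayed) inequalities reversed.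
   Context: All geodesics are parametrized by $[0,1]$; the signed length of a geodesic $\gamma$ is $|\gamma|=\operatorname{sgn}(E)\sqrt{|E|}$ with $E=\langle\gamma'(0),\gamma'(0)\rangle$. For points $p,q$ of a triangle, $\gamma_{pq}$ is the geodesic from $p=\gamma_{pq}(0)$ to $q$, and $|pq|=|\gamma_{pq}|$. The nonnormalized angle is $\angle pqr=\langle\gamma_{qp}'(0),\gamma_{qr}'(0)\rangle$ (inner product at $q$). Model planes of curvature $K$: $S_K$ is the simply connected 2-dimensional Riemannian space form of constant curvature $K$; $M_K$ is the simply connected 2-dimensional Lorentz space form of constant curvature $K$; $-S_{-K}$ is $S_{-K}$ with the sign of the metric switched (negative definite, of constant curvature $K$). $T^+\subset\mathbb{R}^3$ is the set of triples of positive numbers the largest of which is less than the sum of the other two, and $T^-=-T^+$. Set $\pi/\sqrt{k}=\infty$ if $k\le 0$. A point of $\mathbb{R}^3\setminus\{(0,0,0)\}$ satisfies size bounds for $K$ if: it is in $T^+$ and its coordinate sum is $<2\pi/\sqrt K$; or it is in $T^-$ and its coordinate sum is $>-2\pi/\sqrt{-K}$; or it is not in $T^+\cup T^-$, its largest coordinate is $<\pi/\sqrt K$ if $K>0$, and its smallest coordinate is $>-\pi/\sqrt{-K}$ if $K<0$. A triangle satisfies size bounds for $K$ if its triple of signed sidelengths does; it is then the realization, unique up to isometry, of this triple in a model plane of curvature $K$ (triples in $T^+$ are realized in $S_K$, those in $T^-$ in $-S_{-K}$, other nondegenerate triples in $M_K$; nonzero triples with entries all of one sign, zero allowed, one of which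 is the sum of the other two, are realized by a geodesic segment in $M_K$ or in the definite model plane of that sign). Triangles in model planes are understood as such realizations. *)

(* Defs.v *)
From Stdlib Require Export Reals.
From Coquelicot Require Export Coquelicot.
Open Scope R_scope.

(** ** Model planes of curvature [K] *)

(** [riem], [lorentz], [neg_riem] stand for S_K, M_K and -S_{-K}. *)
Inductive model := riem | lorentz | neg_riem.

(** The two signs of the metric on the tangent plane, in an orthonormal basis. *)
Definition sgx (S : model) : R :=
  match S with riem | lorentz => 1 | neg_riem => - 1 end.
Definition sgy (S : model) : R :=
  match S with riem => 1 | lorentz | neg_riem => - 1 end.

Record vec := Vec { vz : R; vx : R; vy : R }.

(** The metric is [dz^2 / K + sgx dx^2 + sgy dy^2].  For [K <> 0], putting
    [X0 = z / sqrt |K|], this is the form [sgn(K) dX0^2 + sgx dx^2 + sgy dy^2],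
    and the quadric of [on_quadric] below is [<X,X> = 1/K], the space form of
    curvature [K].  For [K = 0] the surface is the flat plane [z = 1]; its
    tangent vectors have [vz = 0], so the first summand vanishes. *)
Definition inner (K : R) (S : model) (u v : vec) : R :=
  vz u * vz v / K + sgx S * (vx u * vx v) + sgy S * (vy u * vy v).

Definition on_quadric (K : R) (S : model) (u : vec) : Prop :=
  vz u ^ 2 + K * (sgx S * vx u ^ 2 + sgy S * vy u ^ 2) = 1.

(** [lift] is the extra coordinate of the universal cover of the quadric; it
    is only used for M_K with [K <> 0], and is [0] in the other planes. *)
Record point := Point { coord : vec; lift : R }.

(** For the definite planes the quadric is a sphere, or has two sheets, of which
    we keep [z > 0].  For M_K with [K <> 0] the quadric is diffeomorphic to
    [S^1 x R]; a point of its universal cover is a point of the quadric with a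
    real determination of its angle around the axis. *)
Definition in_plane (K : R) (S : model) (P : point) : Prop :=
  let u := coord P in
  on_quadric K S u /\
  match S with
  | riem => (K <= 0 -> 0 < vz u) /\ lift P = 0
  | neg_riem => (0 <= K -> 0 < vz u) /\ lift P = 0
  | lorentz =>
      (0 < K ->
         vz u = sqrt (1 + K * vy u ^ 2) * cos (lift P) /\
         sqrt K * vx u = sqrt (1 + K * vy u ^ 2) * sin (lift P)) /\
      (K < 0 ->
         vz u = sqrt (1 - K * vx u ^ 2) * cos (lift P) /\
         sqrt (- K) * vy u = sqrt (1 - K * vx u ^ 2) * sin (lift P)) /\
      (K = 0 -> 0 < vz u /\ lift P = 0)
  end.

(** ** Geodesics *)

Definition curve := R -> point.

Definition velocity (g : curve) (t : R) : vec :=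
  Vec (Derive (fun s => vz (coord (g s))) t)
      (Derive (fun s => vx (coord (g s))) t)
      (Derive (fun s => vy (coord (g s))) t).

(** The covariant acceleration of a curve in the surface is
    [g'' + K <g',g'> g] (the component of [g''] tangent to the quadric);
    this says that its coordinate [c] exists and vanishes. *)
Definition geodesic_coord (K : R) (S : model) (g : curve) (c : vec -> R) : Prop :=
  let f := fun s => c (coord (g s)) in
  forall t, ex_derive f t /\
    is_derive (Derive f) t (- (K * inner K S (velocity g t) (velocity g t) * f t)).

(** The model planes are geodesically complete, so geodesics on [0,1] are given
    as (restrictions of) geodesics on the whole line. *)
Definition geodesic (K : R) (S : model) (g : curve) : Prop :=
  (forall t, in_plane K S (g t)) /\
  (forall t, continuous (fun s => lift (g s)) t) /\
  geodesic_coord K S g vz /\ geodesic_coord K S g vx /\ geodesic_coord K S g vy.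

Definition joins (K : R) (S : model) (g : curve) (a b : point) : Prop :=
  geodesic K S g /\ g 0 = a /\ g 1 = b.

(** The piece of [g] from [g a] to [g b], reparametrized affinely by [0,1];
    [a > b] is allowed and reverses the direction. *)
Definition subarc (g : curve) (a b : R) : curve := fun s => g ((1 - s) * a + s * b).
Definition rev (g : curve) : curve := subarc g 1 0.

Definition slength (K : R) (S : model) (g : curve) : R :=
  let E := inner K S (velocity g 0) (velocity g 0) in sign E * sqrt (Rabs E).

(** Nonnormalized angle between two geodesics issuing from the same point. *)
Definition nangle (K : R) (S : model) (g h : curve) : R :=
  inner K S (velocity g 0) (velocity h 0).

(** ** Triangles *)

(** The sides are [ab], [bc], [ac], directed from the first to the second vertex. *)
Definition geod_triangle (K : R) (S : model) (a b c : point) (ab bc ac : curve) : Prop :=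
  joins K S ab a b /\ joins K S bc b c /\ joins K S ac a c.

Definition Tplus (a b c : R) : Prop :=
  0 < a /\ 0 < b /\ 0 < c /\ a < b + c /\ b < a + c /\ c < a + b.
Definition Tminus (a b c : R) : Prop := Tplus (- a) (- b) (- c).

Definition size_bounds (K a b c : R) : Prop :=
  ~ (a = 0 /\ b = 0 /\ c = 0) /\
  (Tplus a b c -> 0 < K -> a + b + c < 2 * PI / sqrt K) /\
  (Tminus a b c -> K < 0 -> - (2 * PI / sqrt (- K)) < a + b + c) /\
  (~ Tplus a b c -> ~ Tminus a b c ->
     (0 < K -> Rmax a (Rmax b c) < PI / sqrt K) /\
     (K < 0 -> - (PI / sqrt (- K)) < Rmin a (Rmin b c))).

(* Main.v *)
(* Along a geodesic [g] of energy [E], half the squared chord [f] to a fixed point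
   of the quadric satisfies [f'' = E - K E f], and [f'] at an endpoint of a
   geodesic [c] issuing from that point is [sn (K |c|^2) <g', c'>], so angles are
   derivatives of such functions. The functions of the two subtriangles form a
   broken function on the side pr, which agrees with that of the large triangle at
   both ends, and the angle hypothesis is the sign of its kink. The difference
   solves the Jacobi equation [y'' = - K E y] on both pieces; as [K E < PI^2] by
   the size bounds, the kink determines the signs of its end derivatives. Only
   ambient coordinates matter, so the lift to the universal cover plays no role. *)
Require Import Defs.
From Stdlib Require Import Reals Lra Classical.
From Coquelicot Require Import Coquelicot.
Open Scope R_scope.

(** * Generalized sine and cosine, and the Jacobi equation *)

(** The solution of [y'' = - k y] with [y 0 = 1] and [y' 0 = 0]; [sn] below is the one with initial
    data 0 and 1. The parameter will be [k = K E], which takes any sign because the energy [E]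
    does. *)
Definition cs (k t : R) : R :=
  if Rlt_dec 0 k then cos (sqrt k * t)
  else if Rlt_dec k 0 then cosh (sqrt (- k) * t) else 1.

Definition sn (k t : R) : R :=
  if Rlt_dec 0 k then sin (sqrt k * t) / sqrt k
  else if Rlt_dec k 0 then sinh (sqrt (- k) * t) / sqrt (- k) else t.

Lemma is_derive_sn (k t : R) : is_derive (sn k) t (cs k t).
Proof.
unfold sn, cs; destruct (Rlt_dec 0 k) as [hk|hk]; [|destruct (Rlt_dec k 0) as [hk'|hk']].
- assert (h := sqrt_lt_R0 k hk).
  auto_derive; [easy | field; lra].
- assert (h : 0 < sqrt (- k)) by (apply sqrt_lt_R0; lra).
  unfold sinh, cosh; auto_derive; [easy | field; lra].
- auto_derive; easy.
Qed.

Lemma is_derive_cs (k t : R) : is_derive (cs k) t (- (k * sn k t)).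
Proof.
unfold sn, cs; destruct (Rlt_dec 0 k) as [hk|hk]; [|destruct (Rlt_dec k 0) as [hk'|hk']].
- assert (h := sqrt_lt_R0 k hk).
  assert (e := sqrt_sqrt k (Rlt_le _ _ hk)).
  auto_derive; [easy | rewrite <- e at 3; field; lra].
- assert (h : 0 < sqrt (- k)) by (apply sqrt_lt_R0; lra).
  assert (e : sqrt (- k) * sqrt (- k) = - k) by (apply sqrt_sqrt; lra).
  replace (- (k * (sinh (sqrt (- k) * t) / sqrt (- k))))
    with (sqrt (- k) * sinh (sqrt (- k) * t)).
  + unfold sinh, cosh; auto_derive; [easy | field].
  + replace k with (- (sqrt (- k) * sqrt (- k))) at 3 by lra; field; lra.
- replace k with 0 by lra; auto_derive; [easy | ring].
Qed.

Lemma cs_0 (k : R) : cs k 0 = 1.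
Proof.
unfold cs; destruct (Rlt_dec 0 k); [|destruct (Rlt_dec k 0)]; rewrite ?Rmult_0_r;
  auto using cos_0, cosh_0.
Qed.

Lemma sn_0 (k : R) : sn k 0 = 0.
Proof.
unfold sn; destruct (Rlt_dec 0 k); [|destruct (Rlt_dec k 0)]; rewrite ?Rmult_0_r;
  rewrite ?sin_0, ?sinh_0; unfold Rdiv; ring.
Qed.

(** For positive [k] the bound puts [sqrt k] before the first positive zero of the sine; the other
    two branches have no positive zero. The length bounds take effect through this positivity. *)
Lemma sn_pos (k : R) : k < PI ^ 2 -> 0 < sn k 1.
Proof.
intros bk; unfold sn; destruct (Rlt_dec 0 k) as [hk|hk];
  [|destruct (Rlt_dec k 0) as [hk'|hk']]; [| | lra]; rewrite Rmult_1_r.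
- assert (h := sqrt_lt_R0 k hk).
  apply Rdiv_lt_0_compat; [|easy]; apply sin_gt_0; [easy|].
  assert (hP := PI_RGT_0).
  rewrite <- (sqrt_pow2 PI) by lra; apply sqrt_lt_1; nra.
- assert (h : 0 < sqrt (- k)) by (apply sqrt_lt_R0; lra).
  apply Rdiv_lt_0_compat; [|easy]; rewrite <- sinh_0; apply sinh_lt, h.
Qed.

Lemma is_derive_0_const (f : R -> R) :
  (forall t, is_derive f t 0) -> forall s t, f s = f t.
Proof.
intros h.
assert (lt : forall s t, s < t -> f s = f t) by
  (intros s t st; apply (eq_is_derive f s t); [intros u _; apply h | easy]).
intros s t; destruct (Rtotal_order s t) as [l|[l|l]];
  [now apply lt | now rewrite l | symmetry; now apply lt].
Qed.

Lemma cs_sn_1 (k t : R) : cs k t ^ 2 + k * sn k t ^ 2 = 1.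
Proof.
rewrite (is_derive_0_const (fun t => cs k t ^ 2 + k * sn k t ^ 2)) with (t := 0).
- rewrite cs_0, sn_0; ring.
- intros u; evar_last.
  + apply (is_derive_plus (fun t => cs k t ^ 2) (fun t => k * sn k t ^ 2)).
    * apply (is_derive_pow (cs k)), is_derive_cs.
    * apply (is_derive_scal (fun t => sn k t ^ 2)), (is_derive_pow (sn k)), is_derive_sn.
  + unfold plus, scal; simpl; unfold mult; simpl; ring.
Qed.

Lemma is_derive_affine (f f' : R -> R) (a b : R) :
  (forall t, is_derive f t (f' t)) ->
  forall t, is_derive (fun t => f (a + b * t)) t (b * f' (a + b * t)).
Proof.
intros df t; apply (is_derive_comp f (fun t => a + b * t)); [apply df |].
auto_derive; [easy | ring].
Qed.

(** Transporting the data at time [a + t] back by time [t] gives the two combinations [w1] and [w2],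
    whose derivatives vanish. The linear system they form has determinant
    [cs k t ^ 2 + k * sn k t ^ 2 = 1] and is solved for [f] and [f']. Negative [t] is allowed. *)
Lemma jacobi_solution (k : R) (f f' : R -> R) :
  (forall t, is_derive f t (f' t)) ->
  (forall t, is_derive f' t (- (k * f t))) ->
  forall a t, f (a + t) = f a * cs k t + f' a * sn k t /\
              f' (a + t) = f' a * cs k t - k * f a * sn k t.
Proof.
intros df df' a t.
assert (shift : forall h h' : R -> R, (forall t, is_derive h t (h' t)) ->
                forall t, is_derive (fun t => h (a + t)) t (h' (a + t))).
{ intros h h' dh u; replace u with (1 * u) at 2 by ring; rewrite <- (Rmult_1_l (h' _)).
  apply (is_derive_ext (fun t => h (a + 1 * t))); [intros s; now rewrite Rmult_1_l |].
  now apply is_derive_affine. }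
assert (dfa := shift _ _ df).
assert (dfa' := shift _ (fun t => - (k * f t)) df').
assert (w1 : f (a + t) * cs k t - f' (a + t) * sn k t = f a).
{ rewrite (is_derive_0_const (fun t => f (a + t) * cs k t - f' (a + t) * sn k t))
    with (t := 0); [rewrite cs_0, sn_0, Rplus_0_r; ring |].
  intros u; evar_last.
  - apply (is_derive_minus (fun t => f (a + t) * cs k t) (fun t => f' (a + t) * sn k t)).
    + apply (is_derive_mult (fun t => f (a + t)) (cs k));
        [apply dfa | apply is_derive_cs | apply Rmult_comm].
    + apply (is_derive_mult (fun t => f' (a + t)) (sn k));
        [apply dfa' | apply is_derive_sn | apply Rmult_comm].
  - unfold minus, plus, opp, mult; simpl; ring. }
assert (w2 : f' (a + t) * cs k t + k * f (a + t) * sn k t = f' a).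
{ rewrite (is_derive_0_const (fun t => f' (a + t) * cs k t + k * f (a + t) * sn k t))
    with (t := 0); [rewrite cs_0, sn_0, Rplus_0_r; ring |].
  intros u; evar_last.
  - apply (is_derive_plus (fun t => f' (a + t) * cs k t)
                          (fun t => k * f (a + t) * sn k t)).
    + apply (is_derive_mult (fun t => f' (a + t)) (cs k));
        [apply dfa' | apply is_derive_cs | apply Rmult_comm].
    + apply (is_derive_mult (fun t => k * f (a + t)) (sn k));
        [apply (is_derive_scal (fun t => f (a + t))), dfa | apply is_derive_sn
        | apply Rmult_comm].
  - unfold minus, plus, opp, mult, scal; simpl; unfold mult; simpl; ring. }
assert (e := cs_sn_1 k t).
split.
- transitivity (f (a + t) * (cs k t ^ 2 + k * sn k t ^ 2)); [rewrite e; ring |].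
  rewrite <- w1, <- w2; ring.
- transitivity (f' (a + t) * (cs k t ^ 2 + k * sn k t ^ 2)); [rewrite e; ring |].
  rewrite <- w1, <- w2; ring.
Qed.

(** [sn k] itself solves the equation with derivative [cs k], so its data at [s] determine it at
    [s + t]. *)
Lemma sn_add (k s t : R) : sn k (s + t) = sn k s * cs k t + cs k s * sn k t.
Proof.
apply (jacobi_solution k (sn k) (cs k)); intros u; [apply is_derive_sn | apply is_derive_cs].
Qed.

(** A change of speed by [l] turns the constant [k] into [k * l ^ 2], so every value becomes one at
    time 1. The choice [l = -1] gives the parity of both functions. *)
Lemma sn_cs_scal (k l : R) :
  sn k l = l * sn (k * l ^ 2) 1 /\ cs k l = cs (k * l ^ 2) 1.
Proof.
assert (ds := is_derive_affine _ _ 0 l (is_derive_sn k)).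
assert (dc := is_derive_affine _ _ 0 l (is_derive_cs k)).
split.
- destruct (jacobi_solution (k * l ^ 2) (fun t => sn k (0 + l * t))
    (fun t => l * cs k (0 + l * t))) with (a := 0) (t := 1) as [h _].
  + apply ds.
  + intros u; evar_last; [apply (is_derive_scal (fun t => cs k (0 + l * t))), dc |].
    ring.
  + rewrite !Rplus_0_l, Rmult_0_r, Rmult_1_r, sn_0, cs_0 in h; lra.
- destruct (jacobi_solution (k * l ^ 2) (fun t => cs k (0 + l * t))
    (fun t => l * - (k * sn k (0 + l * t)))) with (a := 0) (t := 1) as [h _].
  + apply dc.
  + intros u; evar_last.
    * apply (is_derive_scal (fun t => - (k * sn k (0 + l * t)))).
      apply (is_derive_opp (fun t => k * sn k (0 + l * t))).
      apply (is_derive_scal (fun t => sn k (0 + l * t))), ds.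
    * unfold opp; simpl; ring.
  + rewrite !Rplus_0_l, Rmult_0_r, Rmult_1_r, sn_0, cs_0 in h; lra.
Qed.

(** * The kink of a broken solution and its end derivatives *)

(* [f1] and [f2] live on [0,1] and are compared with [f (l t)] and
   [f (l + (1 - l) t)], so that [l = 0] and [l = 1] need no separate treatment. *)
Lemma kink (k E l : R) (f f' f1 f1' f2 f2' : R -> R) :
  k < PI ^ 2 -> 0 <= l <= 1 ->
  (forall t, is_derive f t (f' t)) -> (forall t, is_derive f' t (E - k * f t)) ->
  (forall t, is_derive f1 t (f1' t)) ->
  (forall t, is_derive f1' t (l ^ 2 * E - k * l ^ 2 * f1 t)) ->
  (forall t, is_derive f2 t (f2' t)) ->
  (forall t, is_derive f2' t ((1 - l) ^ 2 * E - k * (1 - l) ^ 2 * f2 t)) ->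
  f1 0 = f 0 -> f2 1 = f 1 -> f1 1 = f2 0 ->
  exists s s1 s2, 0 < s /\ 0 < s1 /\ 0 < s2 /\
    s * (f1' 0 - l * f' 0) = s2 * ((1 - l) * f1' 1 - l * f2' 0) /\
    s * ((1 - l) * f' 1 - f2' 1) = s1 * ((1 - l) * f1' 1 - l * f2' 0).
Proof.
intros bk bl df df' df1 df1' df2 df2' e0 e1 em.
(* In the difference of a piece and the reparametrized [f], the constant terms [b ^ 2 * E] cancel,
   leaving the homogeneous equation with constant [k * b ^ 2]. *)
assert (jac : forall (a b : R) (g g' : R -> R), (forall t, is_derive g t (g' t)) ->
  (forall t, is_derive g' t (b ^ 2 * E - k * b ^ 2 * g t)) ->
  forall c t,
    g (c + t) - f (a + b * (c + t)) =
      (g c - f (a + b * c)) * cs (k * b ^ 2) t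
      + (g' c - b * f' (a + b * c)) * sn (k * b ^ 2) t /\
    g' (c + t) - b * f' (a + b * (c + t)) =
      (g' c - b * f' (a + b * c)) * cs (k * b ^ 2) t
      - k * b ^ 2 * (g c - f (a + b * c)) * sn (k * b ^ 2) t).
{ intros a b g g' dg dg'.
  apply (jacobi_solution (k * b ^ 2) (fun t => g t - f (a + b * t))
                         (fun t => g' t - b * f' (a + b * t))).
  - intros t; apply (is_derive_minus g (fun t => f (a + b * t))); [apply dg |].
    now apply is_derive_affine.
  - intros t; evar_last.
    + apply (is_derive_minus g' (fun t => b * f' (a + b * t))); [apply dg' |].
      apply (is_derive_scal (fun t => f' (a + b * t))).
      apply (is_derive_affine f' (fun t => E - k * f t)), df'.
    + unfold minus, plus, opp; simpl; ring. }
(* Each piece is solved from its outer end, where the difference vanishes: the first forward from 0,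
   the second backward from 1. *)
destruct (jac 0 l f1 f1' df1 df1' 0 1) as [u1 u1'].
destruct (jac l (1 - l) f2 f2' df2 df2' 1 (-1)) as [u2 u2'].
destruct (sn_cs_scal (k * (1 - l) ^ 2) (-1)) as [os oc].
replace (k * (1 - l) ^ 2 * (-1) ^ 2) with (k * (1 - l) ^ 2) in os, oc by ring.
rewrite os, oc in u2, u2'; clear os oc jac.
assert (bnd : forall x, 0 <= x <= 1 -> k * x ^ 2 < PI ^ 2).
{ intros x bx; assert (hP := pow_lt PI 2 PI_RGT_0).
  assert (x2 : 0 <= x ^ 2 <= 1) by (split; simpl; nra).
  destruct (Rle_dec k 0); nra. }
(* These are the values of [sn] over the whole side and, rescaled to unit time, over the two pieces;
   [add] relates them by the addition theorem. *)
exists (sn k 1), (sn (k * l ^ 2) 1), (sn (k * (1 - l) ^ 2) 1).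
split; [now apply sn_pos |].
split; [apply sn_pos, bnd; lra |]; split; [apply sn_pos, bnd; lra |].
assert (add : sn k 1 = l * sn (k * l ^ 2) 1 * cs (k * (1 - l) ^ 2) 1
                       + cs (k * l ^ 2) 1 * ((1 - l) * sn (k * (1 - l) ^ 2) 1)).
{ destruct (sn_cs_scal k l) as [<- <-], (sn_cs_scal k (1 - l)) as [<- <-].
  rewrite <- sn_add; f_equal; ring. }
rewrite add.
replace (0 + l * 0) with 0 in u1, u1' by ring.
replace (0 + l * (0 + 1)) with l in u1, u1' by ring.
replace (l + (1 - l) * 1) with 1 in u2, u2' by ring.
replace (l + (1 - l) * (1 + -1)) with l in u2, u2' by ring.
replace (0 + 1) with 1 in u1, u1' by ring.
replace (1 + -1) with 0 in u2, u2' by ring.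
rewrite e0, Rminus_diag in u1, u1'; rewrite e1, Rminus_diag in u2, u2'.
set (a := f1' 0 - l * f' 0) in *.
set (b := f2' 1 - (1 - l) * f' 1) in *.
replace ((1 - l) * f' 1 - f2' 1) with (- b) by (unfold b; ring).
(* The function [f] is smooth at [l], so subtracting it does not change the kink. *)
replace ((1 - l) * f1' 1 - l * f2' 0)
  with ((1 - l) * (f1' 1 - l * f' l) - l * (f2' 0 - (1 - l) * f' l)) by ring.
rewrite u1', u2'.
(* Continuity of the difference at the break point, from [em]; it eliminates one of the two end
   derivatives [a] and [b]. *)
assert (m : a * sn (k * l ^ 2) 1 = - b * sn (k * (1 - l) ^ 2) 1) by lra.
split.
- transitivity (l * cs (k * (1 - l) ^ 2) 1 * (a * sn (k * l ^ 2) 1)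
    + cs (k * l ^ 2) 1 * (1 - l) * sn (k * (1 - l) ^ 2) 1 * a); [ring | rewrite m; ring].
- transitivity (- l * sn (k * l ^ 2) 1 * cs (k * (1 - l) ^ 2) 1 * b
    + cs (k * l ^ 2) 1 * (1 - l) * (- b * sn (k * (1 - l) ^ 2) 1)); [ring | rewrite <- m; ring].
Qed.

(** * Vector algebra and differentiation in ambient coordinates *)

Lemma cs_curv_0 (t : R) : cs 0 t = 1.
Proof. unfold cs; destruct (Rlt_dec 0 0); [lra | easy]. Qed.

Lemma is_derive_eq (f : R -> R) (x l l' : R) :
  is_derive f x l -> l = l' -> is_derive f x l'.
Proof. now intros h <-. Qed.

Definition lin (a : R) (u : vec) (b : R) (v : vec) : vec :=
  Vec (a * vz u + b * vz v) (a * vx u + b * vx v) (a * vy u + b * vy v).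

Lemma inner_lin_l (K : R) (S : model) (a b : R) (u v w : vec) :
  inner K S (lin a u b v) w = a * inner K S u w + b * inner K S v w.
Proof. unfold inner, lin, Rdiv; simpl; ring. Qed.

Lemma inner_sym (K : R) (S : model) (u v : vec) : inner K S u v = inner K S v u.
Proof. unfold inner, Rdiv; ring. Qed.

Lemma inner_lin_r (K : R) (S : model) (a b : R) (u v w : vec) :
  inner K S w (lin a u b v) = a * inner K S w u + b * inner K S w v.
Proof. now rewrite inner_sym, inner_lin_l, !(inner_sym _ _ w). Qed.

Lemma inner_self_quadric (K : R) (S : model) (u : vec) :
  K <> 0 -> on_quadric K S u -> inner K S u u = / K.
Proof.
intros hK hu; unfold inner.
replace (/ K) with ((vz u ^ 2 + K * (sgx S * vx u ^ 2 + sgy S * vy u ^ 2)) / K)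
  by (rewrite hu; field; easy).
field; easy.
Qed.

Definition is_vderive (U : R -> vec) (t : R) (V : vec) : Prop :=
  is_derive (fun s => vz (U s)) t (vz V) /\
  is_derive (fun s => vx (U s)) t (vx V) /\
  is_derive (fun s => vy (U s)) t (vy V).

Lemma is_derive_inner (K : R) (S : model) (U W : R -> vec) (t : R) (U' W' : vec) :
  is_vderive U t U' -> is_vderive W t W' ->
  is_derive (fun s => inner K S (U s) (W s)) t
    (inner K S U' (W t) + inner K S (U t) W').
Proof.
intros [uz [ux uy]] [wz [wx wy]]; unfold inner, Rdiv.
evar_last.
- apply (is_derive_plus (fun s => vz (U s) * vz (W s) * / K
                                  + sgx S * (vx (U s) * vx (W s)))
                        (fun s => sgy S * (vy (U s) * vy (W s)))).
  + apply (is_derive_plus (fun s => vz (U s) * vz (W s) * / K)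
                          (fun s => sgx S * (vx (U s) * vx (W s)))).
    * apply (is_derive_ext (fun s => / K * (vz (U s) * vz (W s)))); [intros s; apply Rmult_comm |].
      apply (is_derive_scal (fun s => vz (U s) * vz (W s))).
      apply (is_derive_mult (fun s => vz (U s)) (fun s => vz (W s)));
        [exact uz | exact wz | apply Rmult_comm].
    * apply (is_derive_scal (fun s => vx (U s) * vx (W s))).
      apply (is_derive_mult (fun s => vx (U s)) (fun s => vx (W s)));
        [exact ux | exact wx | apply Rmult_comm].
  + apply (is_derive_scal (fun s => vy (U s) * vy (W s))).
    apply (is_derive_mult (fun s => vy (U s)) (fun s => vy (W s)));
      [exact uy | exact wy | apply Rmult_comm].
- unfold plus, mult; simpl; ring.
Qed.

(** * Geodesics in ambient coordinates *)

Definition energy (K : R) (S : model) (g : curve) (t : R) : R :=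
  inner K S (velocity g t) (velocity g t).

Lemma geodesic_velocity (K : R) (S : model) (g : curve) (t : R) :
  geodesic K S g -> is_vderive (fun s => coord (g s)) t (velocity g t).
Proof.
intros (_ & _ & hz & hx & hy).
split; [|split]; apply Derive_correct; [apply hz | apply hx | apply hy].
Qed.

(** The geodesic equation in vector form. The summand of [lin] with coefficient 0 is padding that
    makes it a scalar multiple. *)
Lemma geodesic_acceleration (K : R) (S : model) (g : curve) (t : R) :
  geodesic K S g ->
  is_vderive (velocity g) t
    (lin (- (K * energy K S g t)) (coord (g t)) 0 (coord (g t))).
Proof.
intros (_ & _ & hz & hx & hy).
split; [|split]; eapply is_derive_eq;
  [exact (proj2 (hz t)) | | exact (proj2 (hx t)) | | exact (proj2 (hy t)) |];
  unfold energy; simpl; ring.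
Qed.

(** Half the derivative of the equation of the quadric. The form without division by [K] also makes
    sense in the flat case. *)
Lemma geodesic_tangent (K : R) (S : model) (g : curve) (t : R) :
  geodesic K S g ->
  vz (coord (g t)) * vz (velocity g t)
  + K * (sgx S * (vx (coord (g t)) * vx (velocity g t))
         + sgy S * (vy (coord (g t)) * vy (velocity g t))) = 0.
Proof.
intros hg; destruct (geodesic_velocity _ _ _ t hg) as (hz & hx & hy).
enough (h : 0 = 2 * (vz (coord (g t)) * vz (velocity g t)
  + K * (sgx S * (vx (coord (g t)) * vx (velocity g t))
         + sgy S * (vy (coord (g t)) * vy (velocity g t))))) by lra.
rewrite <- (Derive_const 1 t); apply is_derive_unique.
apply (is_derive_ext (fun s => vz (coord (g s)) ^ 2 +
  (K * sgx S * vx (coord (g s)) ^ 2 + K * sgy S * vy (coord (g s)) ^ 2))).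
{ intros s; rewrite <- (proj1 (proj1 hg s)); simpl; ring. }
evar_last.
- apply (is_derive_plus (fun s => vz (coord (g s)) ^ 2) (fun s =>
    K * sgx S * vx (coord (g s)) ^ 2 + K * sgy S * vy (coord (g s)) ^ 2)).
  + apply (is_derive_pow (fun s => vz (coord (g s)))), hz.
  + apply (is_derive_plus (fun s => K * sgx S * vx (coord (g s)) ^ 2)
                          (fun s => K * sgy S * vy (coord (g s)) ^ 2)).
    * apply (is_derive_scal (fun s => vx (coord (g s)) ^ 2)).
      apply (is_derive_pow (fun s => vx (coord (g s)))), hx.
    * apply (is_derive_scal (fun s => vy (coord (g s)) ^ 2)).
      apply (is_derive_pow (fun s => vy (coord (g s)))), hy.
- unfold plus; simpl; ring.
Qed.

Lemma geodesic_orthogonal (K : R) (S : model) (g : curve) (t : R) :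
  K <> 0 -> geodesic K S g -> inner K S (coord (g t)) (velocity g t) = 0.
Proof.
intros hK hg; assert (h := geodesic_tangent _ _ _ t hg).
apply (Rmult_eq_reg_l K); [|easy].
rewrite Rmult_0_r, <- h; unfold inner; field; easy.
Qed.

(** The acceleration is a multiple of the position, which is orthogonal to the velocity for
    [K <> 0]; for [K = 0] the acceleration is zero. *)
Lemma energy_const (K : R) (S : model) (g : curve) (s t : R) :
  geodesic K S g -> energy K S g s = energy K S g t.
Proof.
intros hg; apply (is_derive_0_const (energy K S g)); clear s t; intros t.
evar_last.
- apply (is_derive_inner K S (velocity g) (velocity g)); apply geodesic_acceleration, hg.
- rewrite inner_lin_l, inner_lin_r, (inner_sym _ _ (velocity g t)).
  destruct (Req_dec K 0) as [->|hK]; [ring |].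
  rewrite geodesic_orthogonal by easy; ring.
Qed.

(** Since the energy is constant, all three coordinates solve the Jacobi equation with the same
    constant [k]. *)
Lemma geodesic_eq (K : R) (S : model) (g : curve) (a t : R) :
  geodesic K S g ->
  let k := K * energy K S g 0 in
  coord (g (a + t)) = lin (cs k t) (coord (g a)) (sn k t) (velocity g a).
Proof.
intros hg k.
assert (acc : forall s, is_vderive (velocity g) s
                          (lin (- k) (coord (g s)) 0 (coord (g s)))).
{ intros s; unfold k; rewrite (energy_const _ _ _ 0 s hg).
  now apply geodesic_acceleration. }
assert (aux : forall c : vec -> R,
  (forall s, is_derive (fun s => c (coord (g s))) s (c (velocity g s))) ->
  (forall s, is_derive (fun s => c (velocity g s)) s (- k * c (coord (g s)) + 0 * c (coord (g s)))) ->
  c (coord (g (a + t))) = cs k t * c (coord (g a)) + sn k t * c (velocity g a)).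
{ intros c d d'.
  destruct (jacobi_solution k (fun s => c (coord (g s))) (fun s => c (velocity g s)))
    with (a := a) (t := t) as [e _]; [exact d | | rewrite e; ring].
  intros s; eapply is_derive_eq; [apply d' | ring]. }
assert (vel := fun s => geodesic_velocity _ _ _ s hg).
assert (ez := aux vz (fun s => proj1 (vel s)) (fun s => proj1 (acc s))).
assert (ex := aux vx (fun s => proj1 (proj2 (vel s))) (fun s => proj1 (proj2 (acc s)))).
assert (ey := aux vy (fun s => proj2 (proj2 (vel s))) (fun s => proj2 (proj2 (acc s)))).
unfold lin; rewrite <- ez, <- ex, <- ey.
now destruct (coord (g (a + t))).
Qed.

(** * Half the squared chord and its derivatives along a geodesic *)

(* Half the squared chord; for [K <> 0] this is [(1 / K) - <u, v>], the function
   [(1 - cos (sqrt K d)) / K] of the distance [d], and [d^2 / 2] for [K = 0]. *)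
Definition hchord (K : R) (S : model) (u v : vec) : R :=
  inner K S (lin 1 u (-1) v) (lin 1 u (-1) v) / 2.

Lemma hchord_sym (K : R) (S : model) (u v : vec) : hchord K S u v = hchord K S v u.
Proof. unfold hchord; rewrite !inner_lin_l, !inner_lin_r, (inner_sym _ _ v u); field. Qed.

(* The value of [hchord] on points joined by a geodesic of energy [e]; it does
   not depend on the model plane. For [K = 0] the junk term [/ 0] is multiplied by [0]. *)
Definition mdist (K e : R) : R :=
  ((cs (K * e) 1 - 1) ^ 2 * / K + sn (K * e) 1 ^ 2 * e) / 2.

(** By [geodesic_eq] the chord is [cs - 1] times the position plus [sn] times the velocity. For
    [K <> 0] these are orthogonal, with squares [/ K] and the energy. Equal side lengths thus give
    equal chords across different model planes. *)
Lemma hchord_geodesic (K : R) (S : model) (g : curve) :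
  geodesic K S g ->
  hchord K S (coord (g 1)) (coord (g 0)) = mdist K (energy K S g 0).
Proof.
intros hg; unfold hchord, mdist.
assert (e := geodesic_eq K S g 0 1 hg); rewrite Rplus_0_l in e; rewrite e; clear e.
rewrite !inner_lin_l, !inner_lin_r.
rewrite (inner_sym _ _ (velocity g 0) (coord (g 0))); fold (energy K S g 0).
destruct (Req_dec K 0) as [->|hK].
- rewrite Rmult_0_l.
  rewrite cs_curv_0; generalize (/ 0); intros i; field.
- rewrite geodesic_orthogonal by easy.
  rewrite inner_self_quadric by (easy || apply hg); field; easy.
Qed.

Lemma is_vderive_minus_const (U : R -> vec) (t : R) (V w : vec) :
  is_vderive U t V -> is_vderive (fun s => lin 1 (U s) (-1) w) t V.
Proof.
intros (hz & hx & hy).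
assert (aux : forall (c : R -> R) (d b : R), is_derive c t d ->
          is_derive (fun s => 1 * c s + -1 * b) t d).
{ intros c d b dc; eapply is_derive_eq.
  - apply (is_derive_plus (fun s => 1 * c s) (fun _ => -1 * b)).
    + apply (is_derive_scal c), dc.
    + apply (is_derive_const (-1 * b)).
  - unfold plus, zero; simpl; ring. }
split; [|split]; simpl; now apply aux.
Qed.

Lemma is_derive_hchord (K : R) (S : model) (g : curve) (u : vec) (t : R) :
  geodesic K S g ->
  is_derive (fun s => hchord K S (coord (g s)) u) t
    (inner K S (velocity g t) (lin 1 (coord (g t)) (-1) u)).
Proof.
intros hg; assert (d := is_vderive_minus_const _ _ _ u (geodesic_velocity _ _ _ t hg)).
eapply is_derive_eq.
- apply (is_derive_ext (fun s => / 2 * inner K S (lin 1 (coord (g s)) (-1) u)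
                                               (lin 1 (coord (g s)) (-1) u))).
  { intros s; unfold hchord; simpl; field. }
  apply (is_derive_scal (fun s => inner K S (lin 1 (coord (g s)) (-1) u)
                                            (lin 1 (coord (g s)) (-1) u))).
  apply is_derive_inner; exact d.
- cbv beta; rewrite (inner_sym K S (lin _ _ _ _) (velocity g t)); field.
Qed.

(** The velocity paired with itself gives the energy. For [K <> 0] both points have square [/ K], so
    the position paired with the chord is [hchord], and the acceleration contributes the second
    term; for [K = 0] that term vanishes. *)
Lemma is_derive2_hchord (K : R) (S : model) (g : curve) (u : vec) (t : R) :
  geodesic K S g -> on_quadric K S u ->
  is_derive (fun s => inner K S (velocity g s) (lin 1 (coord (g s)) (-1) u)) t
    (energy K S g 0 - K * energy K S g 0 * hchord K S (coord (g t)) u).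
Proof.
intros hg hu.
assert (acc := geodesic_acceleration K S g t hg).
assert (d := is_vderive_minus_const _ _ _ u (geodesic_velocity _ _ _ t hg)).
eapply is_derive_eq; [apply is_derive_inner; [exact acc | exact d] |].
rewrite (energy_const K S g t 0 hg); fold (energy K S g t); rewrite (energy_const K S g t 0 hg).
unfold hchord; rewrite !inner_lin_l, !inner_lin_r.
destruct (Req_dec K 0) as [->|hK]; [ring |].
rewrite !inner_self_quadric by (easy || apply hg).
rewrite (inner_sym K S u); field; easy.
Qed.

(** * First variation: from end derivatives to angles *)

(** In the expansion by [geodesic_eq], the position has coefficient [1 - cs]: it is orthogonal to
    [v] when [K <> 0], and its coefficient is 0 when [K = 0]. Only the velocity term survives. *)
Lemma inner_secant (K : R) (S : model) (c : curve) (v : vec) (a t : R) :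
  geodesic K S c ->
  (K <> 0 -> inner K S (coord (c a)) v = 0) ->
  inner K S v (lin 1 (coord (c a)) (-1) (coord (c (a + t)))) =
    - (sn (K * energy K S c 0) t * inner K S v (velocity c a)).
Proof.
intros hc hv; rewrite (geodesic_eq K S c a t hc).
rewrite !inner_lin_r, (inner_sym K S v (coord (c a))).
destruct (Req_dec K 0) as [->|hK]; [| rewrite hv by easy; ring].
rewrite Rmult_0_l, cs_curv_0; ring.
Qed.

Lemma inner_secant_start (K : R) (S : model) (c : curve) (v : vec) :
  geodesic K S c ->
  (K <> 0 -> inner K S (coord (c 0)) v = 0) ->
  inner K S v (lin 1 (coord (c 0)) (-1) (coord (c 1))) =
    - (sn (K * energy K S c 0) 1 * inner K S v (velocity c 0)).
Proof.
intros hc hv; rewrite <- inner_secant by easy; now rewrite Rplus_0_l.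
Qed.

(** The geodesic is followed backward for time -1; oddness of [sn] changes the sign. *)
Lemma inner_secant_end (K : R) (S : model) (c : curve) (v : vec) :
  geodesic K S c ->
  (K <> 0 -> inner K S (coord (c 1)) v = 0) ->
  inner K S v (lin 1 (coord (c 1)) (-1) (coord (c 0))) =
    sn (K * energy K S c 0) 1 * inner K S v (velocity c 1).
Proof.
intros hc hv; assert (e := inner_secant K S c v 1 (-1) hc hv).
destruct (sn_cs_scal (K * energy K S c 0) (-1)) as [o _].
replace (K * energy K S c 0 * (-1) ^ 2) with (K * energy K S c 0) in o by ring.
replace (1 + -1) with 0 in e by ring; rewrite e, o; ring.
Qed.

(** * Subarcs, signed lengths and size bounds *)

Lemma velocity_subarc (K : R) (S : model) (g : curve) (a b : R) :
  geodesic K S g ->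
  velocity (subarc g a b) 0 = lin (b - a) (velocity g a) 0 (velocity g a).
Proof.
intros hg; destruct (geodesic_velocity _ _ _ a hg) as (hz & hx & hy).
assert (aux : forall (c : R -> R) (d : R), is_derive c a d ->
          Derive (fun s => c ((1 - s) * a + s * b)) 0 = (b - a) * d + 0 * d).
{ intros c d dc; apply is_derive_unique; eapply is_derive_eq.
  - apply (is_derive_comp c (fun s => (1 - s) * a + s * b)).
    + replace ((1 - 0) * a + 0 * b) with a by ring; exact dc.
    + auto_derive; [easy | reflexivity].
  - unfold scal; simpl; unfold mult; simpl; ring. }
unfold velocity at 1, subarc, lin; f_equal;
  [apply (aux (fun s => vz (coord (g s)))) | apply (aux (fun s => vx (coord (g s))))
  | apply (aux (fun s => vy (coord (g s))))]; assumption.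
Qed.

Lemma energy_subarc (K : R) (S : model) (g : curve) (a b : R) :
  geodesic K S g -> energy K S (subarc g a b) 0 = (b - a) ^ 2 * energy K S g 0.
Proof.
intros hg; unfold energy at 1; rewrite (velocity_subarc K S) by easy.
rewrite inner_lin_l, inner_lin_r; fold (energy K S g a).
rewrite (energy_const K S g a 0) by easy; ring.
Qed.

(** The map sending [x] to [x * Rabs x] inverts the signed square root, so conditions on signed
    lengths become conditions on energies. *)
Lemma slength_sq (K : R) (S : model) (g : curve) :
  slength K S g * Rabs (slength K S g) = energy K S g 0.
Proof.
unfold slength; fold (energy K S g 0); set (e := energy K S g 0).
assert (q := sqrt_sqrt (Rabs e) (Rabs_pos e)); assert (q' := sqrt_pos (Rabs e)).
rewrite Rabs_mult, (Rabs_pos_eq (sqrt _)) by easy.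
destruct (Rtotal_order e 0) as [h|[h|h]].
- rewrite sign_eq_m1, (Rabs_left (-1)) by lra; assert (a := Rabs_left e h); lra.
- rewrite h, sign_0; ring.
- rewrite sign_eq_1, (Rabs_pos_eq 1) by lra; assert (a := Rabs_right e); lra.
Qed.

Lemma energy_of_slength (K : R) (S S' : model) (g g' : curve) :
  slength K S g = slength K S' g' -> energy K S g 0 = energy K S' g' 0.
Proof. intros h; now rewrite <- !slength_sq, h. Qed.

(** When [K] and [l] have the same sign the relevant bound is squared; otherwise the left side is at
    most 0. *)
Lemma slength_bound (K l : R) :
  (0 < K -> l < PI / sqrt K) -> (K < 0 -> - (PI / sqrt (- K)) < l) ->
  K * (l * Rabs l) < PI ^ 2.
Proof.
assert (hP := pow_lt PI 2 PI_RGT_0).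
assert (aux : forall k x, 0 < k -> 0 <= x -> x < PI / sqrt k -> k * (x * x) < PI ^ 2).
{ intros k x hk hx h; assert (s := sqrt_lt_R0 k hk); assert (q := sqrt_sqrt k (Rlt_le _ _ hk)).
  apply Rlt_div_r in h; [|easy].
  rewrite <- q; replace (sqrt k * sqrt k * (x * x)) with ((x * sqrt k) ^ 2) by ring.
  assert (0 <= x * sqrt k) by nra; nra. }
intros hp hn; destruct (Rle_dec 0 l) as [hl|hl].
- rewrite Rabs_pos_eq by easy; destruct (Rlt_dec 0 K) as [hK|hK]; [now apply aux; auto |].
  nra.
- rewrite Rabs_left by lra; destruct (Rlt_dec K 0) as [hK|hK].
  + replace (K * (l * - l)) with (- K * (- l * - l)) by ring.
    apply aux; try lra; specialize (hn hK); lra.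
  + nra.
Qed.

(** In [Tplus] the triangle inequality makes each side less than half the perimeter, hence less than
    [PI / sqrt K]; [Tminus] is symmetric. In the remaining case the bounds on the maximum and
    minimum apply directly. *)
Lemma size_bounds_sides (K a b c : R) :
  size_bounds K a b c ->
  K * (a * Rabs a) < PI ^ 2 /\ K * (b * Rabs b) < PI ^ 2 /\ K * (c * Rabs c) < PI ^ 2.
Proof.
intros (_ & hp & hm & hn).
assert (half : forall x, 2 * PI / sqrt x = 2 * (PI / sqrt x)) by (intros x; unfold Rdiv; ring).
assert (pos : forall x, 0 < x -> 0 < PI / sqrt x)
  by (intros x hx; apply Rdiv_lt_0_compat; [apply PI_RGT_0 | now apply sqrt_lt_R0]).
enough (h : (0 < K -> a < PI / sqrt K /\ b < PI / sqrt K /\ c < PI / sqrt K) /\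
            (K < 0 -> - (PI / sqrt (- K)) < a /\ - (PI / sqrt (- K)) < b /\
                      - (PI / sqrt (- K)) < c))
  by (destruct h as [h h']; split; [|split]; apply slength_bound; (apply h || apply h')).
unfold Tminus in *.
destruct (classic (Tplus a b c)) as [tp|tp];
  [|destruct (classic (Tplus (- a) (- b) (- c))) as [tm|tm]].
- specialize (hp tp); clear hm hn; unfold Tplus in tp; split; intros hK.
  + specialize (hp hK); rewrite half in hp; lra.
  + assert (q := pos (- K) ltac:(lra)); lra.
- specialize (hm tm); clear hp hn; unfold Tplus in tm; split; intros hK.
  + assert (q := pos K hK); lra.
  + specialize (hm hK); rewrite half in hm; lra.
- destruct (hn tp tm) as [h h'].
  assert (m1 := Rmax_l a (Rmax b c)); assert (m2 := Rmax_r a (Rmax b c)).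
  assert (m3 := Rmax_l b c); assert (m4 := Rmax_r b c).
  assert (n1 := Rmin_l a (Rmin b c)); assert (n2 := Rmin_r a (Rmin b c)).
  assert (n3 := Rmin_l b c); assert (n4 := Rmin_r b c).
  split; intros hK; [specialize (h hK) | specialize (h' hK)]; lra.
Qed.

(** * Comparison of the angles *)

Lemma pos_scaled_sign (a b x h : R) :
  0 < a -> 0 < b -> a * x = b * h -> (h >= 0 -> x >= 0) /\ (h <= 0 -> x <= 0).
Proof. intros ha hb e; split; intros hh; nra. Qed.

Theorem lemma2p4 (K : R)
  (S : model) (p q r : point) (pq qr pr : curve)
  (S1 : model) (q1 p1 m1 : point) (q1p1 p1m1 q1m1 : curve)
  (S2 : model) (q2 m2 r2 : point) (q2m2 m2r2 q2r2 : curve)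
  (lambda : R) (m : point)
  (tri : geod_triangle K S p q r pq qr pr)
  (sb : size_bounds K (slength K S pq) (slength K S qr) (slength K S pr))
  (lambda_01 : 0 <= lambda <= 1)
  (m_on_pr : m = pr lambda)
  (tri1 : geod_triangle K S1 q1 p1 m1 q1p1 p1m1 q1m1)
  (tri2 : geod_triangle K S2 q2 m2 r2 q2m2 m2r2 q2r2)
  (len_qm : slength K S1 q1m1 = slength K S2 q2m2)
  (len_qp : slength K S1 q1p1 = slength K S (rev pq))
  (len_qr : slength K S2 q2r2 = slength K S qr)
  (len_pm : slength K S1 p1m1 = slength K S (subarc pr 0 lambda))
  (len_mr : slength K S2 m2r2 = slength K S (subarc pr lambda 1))
  (bound_pos : 0 < K ->
     slength K S1 q1m1 < PI / sqrt K /\ slength K S2 q2m2 < PI / sqrt K)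
  (bound_neg : K < 0 ->
     slength K S1 q1m1 > - (PI / sqrt (- K)) /\
     slength K S2 q2m2 > - (PI / sqrt (- K))) :
  let angle_qpm := nangle K S pq (subarc pr 0 lambda) in
  let angle_qrm := nangle K S (rev qr) (subarc pr 1 lambda) in
  let angle_q1p1m1 := nangle K S1 (rev q1p1) p1m1 in
  let angle_q2r2m2 := nangle K S2 (rev q2r2) (rev m2r2) in
  let angle_p1m1q1 := nangle K S1 (rev p1m1) (rev q1m1) in
  let angle_r2m2q2 := nangle K S2 m2r2 (rev q2m2) in
  ((1 - lambda) * angle_p1m1q1 + lambda * angle_r2m2q2 >= 0 ->
     angle_qpm >= angle_q1p1m1 /\ angle_qrm >= angle_q2r2m2) /\
  ((1 - lambda) * angle_p1m1q1 + lambda * angle_r2m2q2 <= 0 ->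
     angle_qpm <= angle_q1p1m1 /\ angle_qrm <= angle_q2r2m2).
Proof.
intros angle_qpm angle_qrm angle_q1p1m1 angle_q2r2m2 angle_p1m1q1 angle_r2m2q2.
destruct tri as ((gpq & pq0 & pq1) & (gqr & qr0 & qr1) & (gpr & pr0 & pr1)).
destruct tri1 as ((gqp1 & qp10 & qp11) & (gpm1 & pm10 & pm11) & (gqm1 & qm10 & qm11)).
destruct tri2 as ((gqm2 & qm20 & qm21) & (gmr2 & mr20 & mr21) & (gqr2 & qr20 & qr21)).
destruct (size_bounds_sides _ _ _ _ sb) as (bpq & bqr & bpr).
rewrite slength_sq in bpq, bqr, bpr.
assert (bqm : K * energy K S1 q1m1 0 < PI ^ 2).
{ rewrite <- slength_sq; apply slength_bound; intros hK; [apply bound_pos | apply bound_neg];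
    easy. }
set (E := energy K S pr 0) in *.
assert (eqm := energy_of_slength _ _ _ _ _ len_qm).
assert (eqp := energy_of_slength _ _ _ _ _ len_qp).
assert (eqr := energy_of_slength _ _ _ _ _ len_qr).
assert (epm := energy_of_slength _ _ _ _ _ len_pm).
assert (emr := energy_of_slength _ _ _ _ _ len_mr).
(* Reversal preserves energy, and the two parts of the side [pr] have energies [lambda ^ 2 * E] and
   [(1 - lambda) ^ 2 * E], as [kink] requires. *)
unfold rev in eqp; rewrite energy_subarc in eqp, epm, emr by easy; fold E in epm, emr.
replace ((0 - 1) ^ 2 * energy K S pq 0) with (energy K S pq 0) in eqp by ring.
rewrite Rminus_0_r in epm.
assert (hq : on_quadric K S (coord q)) by (rewrite <- qr0; apply gqr).
assert (hq1 : on_quadric K S1 (coord q1)) by (rewrite <- qm10; apply gqm1).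
assert (hq2 : on_quadric K S2 (coord q2)) by (rewrite <- qm20; apply gqm2).
assert (bk : K * E < PI ^ 2) by exact bpr.
destruct (kink (K * E) E lambda
  (fun t => hchord K S (coord (pr t)) (coord q))
  (fun t => inner K S (velocity pr t) (lin 1 (coord (pr t)) (-1) (coord q)))
  (fun t => hchord K S1 (coord (p1m1 t)) (coord q1))
  (fun t => inner K S1 (velocity p1m1 t) (lin 1 (coord (p1m1 t)) (-1) (coord q1)))
  (fun t => hchord K S2 (coord (m2r2 t)) (coord q2))
  (fun t => inner K S2 (velocity m2r2 t) (lin 1 (coord (m2r2 t)) (-1) (coord q2))))
  as (s & s1 & s2 & s_pos & s1_pos & s2_pos & kink_p & kink_r).
- exact bk.
- exact lambda_01.
- intros t; now apply is_derive_hchord.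
- intros t; now apply is_derive2_hchord.
- intros t; now apply is_derive_hchord.
- intros t; eapply is_derive_eq; [now apply is_derive2_hchord |]; rewrite epm; ring.
- intros t; now apply is_derive_hchord.
- intros t; eapply is_derive_eq; [now apply is_derive2_hchord |]; rewrite emr; ring.
(* The three matching conditions, at [p], [r] and the break point: both sides equal [mdist] at a
   common energy. *)
- rewrite pm10, pr0, <- qp11, <- qp10, hchord_geodesic, eqp by easy.
  now rewrite <- pq0, <- pq1, hchord_sym, hchord_geodesic.
- rewrite mr21, pr1, <- qr21, <- qr20, hchord_geodesic, eqr by easy.
  now rewrite <- qr0, <- qr1, hchord_geodesic.
- rewrite pm11, mr20, <- qm11, <- qm10, hchord_geodesic, eqm by easy.
  now rewrite <- qm20, <- qm21, hchord_geodesic.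
- rewrite pm10, pr0, pm11, mr20 in kink_p.
  rewrite pr1, mr21, pm11, mr20 in kink_r.
  (* Only [pq] is directed away from its vertex on the broken side, hence the start version and the
     minus sign here; the other five sides issue from [q], [q1] or [q2]. *)
  assert (gp : inner K S (velocity pr 0) (lin 1 (coord p) (-1) (coord q))
    = - (sn (K * energy K S pq 0) 1 * inner K S (velocity pr 0) (velocity pq 0))).
  { rewrite <- pq0, <- pq1; apply inner_secant_start; [easy |].
    rewrite pq0, <- pr0; intros hK; now apply geodesic_orthogonal. }
  assert (gr : inner K S (velocity pr 1) (lin 1 (coord r) (-1) (coord q))
    = sn (K * energy K S qr 0) 1 * inner K S (velocity pr 1) (velocity qr 1)).
  { rewrite <- qr0, <- qr1; apply inner_secant_end; [easy |].
    rewrite qr1, <- pr1; intros hK; now apply geodesic_orthogonal. }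
  assert (gp1 : inner K S1 (velocity p1m1 0) (lin 1 (coord p1) (-1) (coord q1))
    = sn (K * energy K S pq 0) 1 * inner K S1 (velocity p1m1 0) (velocity q1p1 1)).
  { rewrite <- eqp, <- qp10, <- qp11; apply inner_secant_end; [easy |].
    rewrite qp11, <- pm10; intros hK; now apply geodesic_orthogonal. }
  assert (gm1 : inner K S1 (velocity p1m1 1) (lin 1 (coord m1) (-1) (coord q1))
    = sn (K * energy K S1 q1m1 0) 1 * inner K S1 (velocity p1m1 1) (velocity q1m1 1)).
  { rewrite <- qm10, <- qm11; apply inner_secant_end; [easy |].
    rewrite qm11, <- pm11; intros hK; now apply geodesic_orthogonal. }
  (* By [eqm] the factor [sn] is the same as in [gm1], so it comes out of the whole kink. *)
  assert (gm2 : inner K S2 (velocity m2r2 0) (lin 1 (coord m2) (-1) (coord q2))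
    = sn (K * energy K S1 q1m1 0) 1 * inner K S2 (velocity m2r2 0) (velocity q2m2 1)).
  { rewrite eqm, <- qm20, <- qm21; apply inner_secant_end; [easy |].
    rewrite qm21, <- mr20; intros hK; now apply geodesic_orthogonal. }
  assert (gr2 : inner K S2 (velocity m2r2 1) (lin 1 (coord r2) (-1) (coord q2))
    = sn (K * energy K S qr 0) 1 * inner K S2 (velocity m2r2 1) (velocity q2r2 1)).
  { rewrite <- eqr, <- qr20, <- qr21; apply inner_secant_end; [easy |].
    rewrite qr21, <- mr21; intros hK; now apply geodesic_orthogonal. }
  rewrite gp, gp1, gm1, gm2 in kink_p; rewrite gr, gr2, gm1, gm2 in kink_r.
  assert (sqp := sn_pos _ bpq); assert (sqr := sn_pos _ bqr); assert (sqm := sn_pos _ bqm).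
  set (cqp := sn (K * energy K S pq 0) 1) in *.
  set (cqr := sn (K * energy K S qr 0) 1) in *.
  set (cqm := sn (K * energy K S1 q1m1 0) 1) in *.
  (* Each angle is expressed by velocities of the given sides: a reversal contributes a sign, a
     subarc of [pr] its factor [lambda] or [lambda - 1]. *)
  assert (a1 : angle_qpm = lambda * inner K S (velocity pr 0) (velocity pq 0)).
  { unfold angle_qpm, nangle; rewrite (velocity_subarc K S), inner_lin_r, inner_sym by easy.
    ring. }
  assert (a2 : angle_qrm = (1 - lambda) * inner K S (velocity pr 1) (velocity qr 1)).
  { unfold angle_qrm, nangle, rev;
    rewrite !(velocity_subarc K S), inner_lin_l, !inner_lin_r by easy.
    rewrite inner_sym; ring. }
  assert (a3 : angle_q1p1m1 = - inner K S1 (velocity p1m1 0) (velocity q1p1 1)).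
  { unfold angle_q1p1m1, nangle, rev;
    rewrite (velocity_subarc K S1), inner_lin_l, inner_sym by easy.
    ring. }
  assert (a4 : angle_q2r2m2 = inner K S2 (velocity m2r2 1) (velocity q2r2 1)).
  { unfold angle_q2r2m2, nangle, rev;
    rewrite !(velocity_subarc K S2), inner_lin_l, !inner_lin_r by easy.
    rewrite inner_sym; ring. }
  assert (a5 : angle_p1m1q1 = inner K S1 (velocity p1m1 1) (velocity q1m1 1)).
  { unfold angle_p1m1q1, nangle, rev;
    rewrite !(velocity_subarc K S1), inner_lin_l, !inner_lin_r by easy.
    ring. }
  assert (a6 : angle_r2m2q2 = - inner K S2 (velocity m2r2 0) (velocity q2m2 1)).
  { unfold angle_r2m2q2, nangle, rev;
    rewrite (velocity_subarc K S2), inner_lin_r by easy.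
    ring. }
  (* Up to positive factors, the angle difference at [p], and then the one at [r], equals the
     weighted angle sum at the break point, which settles both directions of inequality. *)
  destruct (pos_scaled_sign (s * cqp) (s2 * cqm) (angle_qpm - angle_q1p1m1)
    ((1 - lambda) * angle_p1m1q1 + lambda * angle_r2m2q2)) as [hp hp'];
    [nra | nra | rewrite a1, a3, a5, a6; lra |].
  destruct (pos_scaled_sign (s * cqr) (s1 * cqm) (angle_qrm - angle_q2r2m2)
    ((1 - lambda) * angle_p1m1q1 + lambda * angle_r2m2q2)) as [hr hr'];
    [nra | nra | rewrite a2, a4, a5, a6; lra |].
  split; intros h; [specialize (hp h); specialize (hr h) | specialize (hp' h); specialize (hr' h)];
    lra.
Qed.
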